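(* In quantum theory (with superselection rules), let $A$ be a system. (i) If $A$ satisfies perfect distinguishability, then $A$ is classical. (ii) If $A$ satisfies indistinguishability, then $A$ is fully quantum. Consequently, a quantum theory in which every system satisfies perfect distinguishability is classical theory (every system is classical), and a quantum theory in which every system satisfies indistinguishability is fully quantum theory (every system is fully quantum).
   Context: In quantum theory with superselection rules, a system $A$ is described by natural numbers $k,n_1,\dots,n_k\ge1$: states and effects of $A$ are the elements of the cone $\bigoplus_{i=1}^k\mathcal S_+(\mathbb C^{n_i})$, viewed as block-diagonal positive semidefinite matrices of order $N_A=\sum_in_i$ ($\mathcal S_+(\mathbb C^n)$ = complex positive semidefinite $n\times n$ matrices). The probability of effect $e$ on state $\rho$ is $\mathrm{Tr}(e\rho)$. A measurement is a finite family of effects summing to the identity matrix. A normalized pure state is a state of trace one and matrix rank one. States $\rho_1,\dots,\rho_m$ are perfectly distinguishable if there is a measurement $\{e_j\}_{j=1}^{M}$, $M\ge m$, with $\mathrm{Tr}(e_i\rho_i)=\mathrm{Tr}\,\rho_i$ for $i=1,\dots,m$. $A$ is classical if $k=N_A$ (all $n_i=1$), and fully quantum if $k=1$. $A$ satisfies perfect distinguishability if any two distinct normalized pure states of $A$ are perfectly distinguishable. $A$ satisfies indistinguishability if for any normalized pure states $\psi,\phi$ of $A$ there exists a normalized pure state $\varphi$ of $A$ such that neither $\psi$ nor $\phi$ is perfectly distinguishable from $\varphi$. *)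

(* Defs.v *)
From mathcomp Require Export all_boot all_order all_algebra.
From mathcomp Require Export reals complex.

Set Implicit Arguments.
Unset Strict Implicit.
Unset Printing Implicit Defensive.

Import Order.TTheory GRing.Theory Num.Theory.
Local Open Scope ring_scope.
Local Open Scope sesquilinear_scope.

Record qsystem := QSystem {
  nblocks : nat;
  blockdim : 'I_nblocks -> nat;
  nblocks_gt0 : (0 < nblocks)%N;
  blockdim_gt0 : forall i, (0 < blockdim i)%N
}.

Definition sysdim (A : qsystem) : nat := (\sum_i blockdim (q := A) i)%N.

Definition classical (A : qsystem) : Prop := nblocks A = sysdim A.

Definition fully_quantum (A : qsystem) : Prop := nblocks A = 1%N.

(* In the order of [R[i]], [0 <= z] means that [z] is real and nonnegative. *)
Definition psd (R : realType) (n : nat) (M : 'M[R[i]]_n) : Prop :=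
  M \is hermsymmx /\
  forall v : 'cV[R[i]]_n, 0 <= (v ^t* *m M *m v) ord0 ord0.

(* Membership in the direct sum of the cones of positive semidefinite matrices
   of the blocks, embedded as block-diagonal matrices.  The cone is self-dual:
   it is the cone of states and also the cone of effects. *)
Definition in_cone (R : realType) (A : qsystem) (M : 'M[R[i]]_(sysdim A)) :
    Prop :=
  exists B : forall i : 'I_(nblocks A), 'M[R[i]]_(blockdim i),
    (forall i, psd (B i)) /\ M = \mxdiag_i B i.

Definition is_state (R : realType) (A : qsystem) (rho : 'M[R[i]]_(sysdim A)) :
  Prop := in_cone rho.

Definition is_effect (R : realType) (A : qsystem) (e : 'M[R[i]]_(sysdim A)) :
  Prop := in_cone e.

Definition prob (R : realType) (A : qsystem) (e rho : 'M[R[i]]_(sysdim A)) :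
  R[i] := \tr (e *m rho).

Definition is_measurement (R : realType) (A : qsystem) (M : nat)
    (e : 'I_M -> 'M[R[i]]_(sysdim A)) : Prop :=
  (forall j, is_effect (e j)) /\ \sum_j e j = 1%:M.

Definition normalized_pure_state (R : realType) (A : qsystem)
    (rho : 'M[R[i]]_(sysdim A)) : Prop :=
  [/\ is_state rho, \tr rho = 1 & \rank rho = 1%N].

Definition perfectly_distinguishable (R : realType) (A : qsystem) (m : nat)
    (rho : 'I_m -> 'M[R[i]]_(sysdim A)) : Prop :=
  exists (M : nat) (le_mM : (m <= M)%N) (e : 'I_M -> 'M[R[i]]_(sysdim A)),
    is_measurement e /\
    forall i : 'I_m, prob (e (widen_ord le_mM i)) (rho i) = \tr (rho i).

Definition pair_distinguishable (R : realType) (A : qsystem)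
    (psi phi : 'M[R[i]]_(sysdim A)) : Prop :=
  perfectly_distinguishable (tnth [tuple psi; phi]).

Definition perfect_distinguishability (R : realType) (A : qsystem) : Prop :=
  forall psi phi : 'M[R[i]]_(sysdim A),
    normalized_pure_state psi -> normalized_pure_state phi -> psi <> phi ->
    pair_distinguishable psi phi.

Definition indistinguishability (R : realType) (A : qsystem) : Prop :=
  forall psi phi : 'M[R[i]]_(sysdim A),
    normalized_pure_state psi -> normalized_pure_state phi ->
    exists chi : 'M[R[i]]_(sysdim A),
      [/\ normalized_pure_state chi,
          ~ pair_distinguishable psi chi
        & ~ pair_distinguishable phi chi].

(* A theory is determined by its class of systems; no closure property of that
   class, such as closure under composition, is imposed. *)
Definition quantum_theory := qsystem -> Prop.

Definition classical_theory (T : quantum_theory) : Prop :=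
  forall A, T A -> classical A.

Definition fully_quantum_theory (T : quantum_theory) : Prop :=
  forall A, T A -> fully_quantum A.

(* Main.v *)
Require Import Defs.
From mathcomp Require Import ring.

(* (i) If some block has dimension at least 2, take in it x = |0> and
   y = |0> + |1>.  Effects e, f separating the corresponding pure states have
   quadratic forms with e(x) = 1 and e(y) = 0.  The identity
   e(2x - y) - e(x - 2y) = 3 (e(x) - e(y)) then forces e(2x - y) >= 3, whereas
   e <= 1 and 2x - y = |0> - |1> has squared norm 2.
   (ii) A block-diagonal matrix of rank one lives in a single block, so given
   pure states in two different blocks, every pure state vanishes on one of the
   two blocks and is separated from the corresponding state by the projection
   onto that block. *)

Set Implicit Arguments.
Unset Strict Implicit.
Unset Printing Implicit Defensive.

Import Order.TTheory GRing.Theory Num.Theory.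
Local Open Scope ring_scope.
Local Open Scope sesquilinear_scope.

(** * Quadratic forms and positive semidefinite matrices *)

Definition qform (R : realType) n (M : 'M[R[i]]_n) (v : 'cV[R[i]]_n) : R[i] :=
  (v ^t* *m M *m v) ord0 ord0.

Lemma adjoint_mulmx (C : numClosedFieldType) m n p
    (M : 'M[C]_(m, n)) (N : 'M[C]_(n, p)) : (M *m N) ^t* = N ^t* *m M ^t*.
Proof. by rewrite trmx_mul map_mxM. Qed.

Lemma qform_sum (R : realType) n (I : finType) (M : I -> 'M[R[i]]_n) v :
  qform (\sum_k M k) v = \sum_k qform (M k) v.
Proof. by rewrite /qform mulmx_sumr mulmx_suml summxE. Qed.

(* Difference of squares: with [a = 2 x - y] and [b = x - 2 y] one has
   [a + b = 3 (x - y)] and [a - b = x + y]. *)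
Lemma qform_difference_of_squares (R : realType) n (M : 'M[R[i]]_n) x y :
  qform M (x *+ 2 - y) - qform M (x - y *+ 2) = (qform M x - qform M y) *+ 3.
Proof.
pose b (u v : 'cV[R[i]]_n) := (u ^t* *m M *m v) ord0 ord0.
have addE (P Q : 'M[R[i]]_1) s t : (P + Q) s t = P s t + Q s t by rewrite mxE.
have subE (P Q : 'M[R[i]]_1) s t : (P - Q) s t = P s t - Q s t.
  by rewrite !mxE.
have bBl u v w : b (u - v) w = b u w - b v w.
  by rewrite /b linearB /= map_mxB !mulmxBl subE.
have bBr u v w : b w (u - v) = b w u - b w v by rewrite /b mulmxBr subE.
have b2l u w : b (u *+ 2) w = b u w *+ 2.
  by rewrite /b !mulr2n linearD /= map_mxD !mulmxDl addE.
have b2r u w : b w (u *+ 2) = b w u *+ 2 by rewrite /b !mulr2n mulmxDr addE.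
rewrite -[LHS]/(b _ _ - b _ _) -[qform M x]/(b x x) -[qform M y]/(b y y).
rewrite !(bBl, bBr, b2l, b2r).
move: (b x x) (b x y) (b y x) (b y y) => p q r s.
ring.
Qed.

Lemma qform1_ge0 (R : realType) n (v : 'cV[R[i]]_n) : 0 <= qform 1%:M v.
Proof.
rewrite /qform mulmx1 mxE sumr_ge0 // => k _.
by rewrite !mxE mulrC mul_conjC_ge0.
Qed.

Lemma psd0 (R : realType) n : psd (0 : 'M[R[i]]_n).
Proof.
split; first by apply/is_hermitianmxP; rewrite expr0 scale1r trmx0 map_mx0.
by move=> v; rewrite mulmx0 mul0mx mxE.
Qed.

Lemma psd1 (R : realType) n : psd (1%:M : 'M[R[i]]_n).
Proof. by split=> [|v]; [exact: hermitian1mx_subproof | exact: qform1_ge0]. Qed.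

(** The quadratic form at [v] is [c] times the squared modulus of the inner product of [v] and [w].
    Being nonnegative, [c] is real, which gives hermitian symmetry. *)
Lemma psd_outer (R : realType) n (c : R[i]) (w : 'cV[R[i]]_n) :
  0 <= c -> psd (c *: (w *m w ^t*)).
Proof.
move=> c_ge0; split=> [|v].
  apply/is_hermitianmxP; rewrite expr0 scale1r linearZ /= map_mxZ /=.
  by rewrite (CrealP (ger0_real c_ge0)) adjoint_mulmx trmxCK.
rewrite -scalemxAr -scalemxAl mxE mulr_ge0 //.
have -> : v ^t* *m (w *m w ^t*) *m v = (v ^t* *m w) *m (v ^t* *m w) ^t*.
  by rewrite adjoint_mulmx trmxCK !mulmxA.
by rewrite mxE big_ord1 !mxE mul_conjC_ge0.
Qed.

(** * Block-diagonal matrices, pure states and measurements *)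

Lemma mul_mxdiag (R : pzSemiRingType) p (p_ : 'I_p -> nat)
    (B C : forall i, 'M[R]_(p_ i)) :
  \mxdiag_i B i *m \mxdiag_i C i = \mxdiag_i (B i *m C i).
Proof.
rewrite {1}/mxdiag mul_mxblock_mxdiag; apply: eq_mxblock => i j.
case: eqP => [<-|_]; last by rewrite mul0mx.
by rewrite !conform_mx_id.
Qed.

Section BlockMatrices.
Variables (R : realType) (A : qsystem).
Implicit Types i j : 'I_(nblocks A).

Let block_with (B : forall j, 'M[R[i]]_(blockdim j)) i C j :=
  @dfwith _ (fun j => 'M[R[i]]_(blockdim j)) B i C j.

Definition block_embed i (C : 'M[R[i]]_(blockdim i)) : 'M[R[i]]_(sysdim A) :=
  \mxdiag_j block_with (fun _ => 0) C j.

Definition block_compl i : 'M[R[i]]_(sysdim A) :=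
  \mxdiag_j @block_with (fun _ => 1%:M) i 0 j.

Lemma block_embed_inj i : injective (@block_embed i).
Proof. by move=> C D /eq_mxdiagP /(_ i); rewrite /block_with !dfwith_in. Qed.

Lemma block_embed_in_cone i C : psd C -> in_cone (@block_embed i C).
Proof.
move=> psdC; exists (block_with (fun _ => 0) C); split=> // j.
by rewrite /block_with; case: dfwithP => // k _; apply: psd0.
Qed.

Lemma block_compl_in_cone i : in_cone (block_compl i).
Proof.
exists (@block_with (fun _ => 1%:M) i 0); split=> // j.
by rewrite /block_with; case: dfwithP => [|k _]; [apply: psd0 | apply: psd1].
Qed.

Lemma block_embed_complement i :
  block_embed (1%:M : 'M_(blockdim i)) + block_compl i = 1%:M.
Proof.
rewrite /block_embed /block_compl -mxdiagD -[RHS]mxdiagZ; apply: eq_mxdiag => j.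
have [<-|ij] := eqVneq i j; first by rewrite /block_with !dfwith_in addr0.
by rewrite /block_with !dfwith_out // add0r.
Qed.

Lemma mxtrace_mul_block_embed (B : forall j, 'M[R[i]]_(blockdim j)) i C :
  \tr (\mxdiag_j B j *m @block_embed i C) = \tr (B i *m C).
Proof.
rewrite mul_mxdiag mxtrace_mxdiag (bigD1 i) //= /block_with dfwith_in.
rewrite big1 ?addr0 // => j.
by rewrite eq_sym => ij; rewrite /block_with dfwith_out // mulmx0 mxtrace0.
Qed.

Lemma mxtrace_block_embed i C : \tr (@block_embed i C) = \tr C.
Proof.
rewrite -[block_embed C]mul1mx -mxdiagZ mxtrace_mul_block_embed.
by rewrite mul1mx.
Qed.

Lemma rank_block_embed i C : \rank (@block_embed i C) = \rank C.
Proof.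
rewrite rank_mxdiag (bigD1 i) //= /block_with dfwith_in big1 ?addn0 // => j.
by rewrite eq_sym => ij; rewrite /block_with dfwith_out // mxrank0.
Qed.

(** The factor [c] is the inverse squared norm of [w], so that unnormalized vectors can be used
    without square roots. *)
Lemma block_embed_pure i (c : R[i]) (w : 'cV[R[i]]_(blockdim i)) :
  0 <= c -> c * qform 1%:M w = 1 ->
  normalized_pure_state (block_embed (c *: (w *m w ^t*))).
Proof.
move=> c_ge0 cw1.
have tr1 : \tr (c *: (w *m w ^t*)) = 1.
  by rewrite mxtraceZ mxtrace_mulC trace_mx11 -[w ^t*]mulmx1.
split; first exact/block_embed_in_cone/psd_outer.
  by rewrite mxtrace_block_embed.
rewrite rank_block_embed; apply/eqP; rewrite eqn_leq; apply/andP; split.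
  apply: leq_trans (mxrank_scale _ _) _.
  by apply: leq_trans (mxrankM_maxl _ _) (rank_leq_col _).
(* The rank is positive because the trace is 1, hence the matrix is nonzero. *)
rewrite lt0n mxrank_eq0; apply/eqP => C0.
by move/eqP: tr1; rewrite C0 mxtrace0 eq_sym oner_eq0.
Qed.

(** Cyclicity of the trace turns a probability into a quadratic form on a single block. *)
Lemma prob_block_embed (B : forall j, 'M[R[i]]_(blockdim j)) i c
    (w : 'cV[R[i]]_(blockdim i)) :
  prob (\mxdiag_j B j) (block_embed (c *: (w *m w ^t*))) = c * qform (B i) w.
Proof.
rewrite /prob mxtrace_mul_block_embed -scalemxAr mxtraceZ mulmxA mxtrace_mulC.
by rewrite mulmxA trace_mx11.
Qed.

Lemma psd_submxblock (M : 'M[R[i]]_(sysdim A)) i :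
  in_cone M -> psd (submxblock M i i).
Proof. by case=> B [psdB ->]; rewrite submxblock_diag. Qed.

Lemma in_cone_mxdiag (M : 'M[R[i]]_(sysdim A)) :
  in_cone M -> M = \mxdiag_i submxblock M i i.
Proof.
by case=> B [_ ->]; apply: eq_mxdiag => i; rewrite submxblock_diag.
Qed.

(** The measurement is the projection onto block [i] and its complement: the first fixes every
    matrix carried by block [i], the second fixes [chi]. *)
Lemma disjoint_blocks_distinguishable i (C : 'M[R[i]]_(blockdim i))
    (chi : 'M[R[i]]_(sysdim A)) :
  in_cone chi -> submxblock chi i i = 0 ->
  pair_distinguishable (block_embed C) chi.
Proof.
move=> chi_cone chi_i0; exists 2%N, (leqnn 2).
exists (tnth [tuple block_embed (1%:M : 'M_(blockdim i)); block_compl i]).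
split; first split.
- case=> -[|[|//]] ?; [exact/block_embed_in_cone/psd1|].
  exact: block_compl_in_cone.
- by rewrite !big_ord_recl big_ord0 addr0 -(block_embed_complement i).
case=> -[|[|//]] ?; rewrite /prob /tnth /=.
  rewrite mxtrace_mul_block_embed /block_with dfwith_in mul1mx.
  by rewrite mxtrace_block_embed.
congr (\tr _).
rewrite {2}(in_cone_mxdiag chi_cone) {1}(in_cone_mxdiag chi_cone).
rewrite mul_mxdiag; apply: eq_mxdiag => j.
have [<-|ij] := eqVneq i j; first by rewrite chi_i0 mulmx0.
by rewrite /block_with dfwith_out // mul1mx.
Qed.

(** Ranks of diagonal blocks add up, so two nonzero blocks would force rank at least 2. *)
Lemma pure_state_block_eq0 (rho : 'M[R[i]]_(sysdim A)) i j :
  normalized_pure_state rho -> i != j ->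
  submxblock rho i i = 0 \/ submxblock rho j j = 0.
Proof.
case=> rho_cone _; rewrite (in_cone_mxdiag rho_cone) rank_mxdiag => + ij.
rewrite (bigD1 i) //= (bigD1 j) 1?eq_sym //= !submxblock_diag => rk.
have [|] := eqVneq (submxblock rho i i) 0; first by left.
have [|] := eqVneq (submxblock rho j j) 0; first by right.
rewrite -!mxrank_eq0 -!lt0n => rj ri.
move: rk; case: (\rank _) ri => // a _; case: (\rank _) rj => // b _.
by rewrite !addSn addnS.
Qed.

End BlockMatrices.

(** Only the first two outcomes of the measurement are kept, block by block. The discarded effects
    have nonnegative forms, so the sum of the two is bounded by the identity rather than equal to
    it. *)
Lemma pair_distinguishableP (R : realType) (A : qsystem)
    (psi phi : 'M[R[i]]_(sysdim A)) :
  pair_distinguishable psi phi ->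
  exists e f : forall i, 'M[R[i]]_(@blockdim A i),
    [/\ forall i v, [/\ 0 <= qform (e i) v, 0 <= qform (f i) v &
                        qform (e i) v + qform (f i) v <= qform 1%:M v],
        prob (\mxdiag_i e i) psi = \tr psi
      & prob (\mxdiag_i f i) phi = \tr phi].
Proof.
case=> -[|[|M]] [] // le2M [e [[e_eff e_sum] e_prob]].
exists (fun i => submxblock (e (widen_ord le2M ord0)) i i).
exists (fun i => submxblock (e (widen_ord le2M ord_max)) i i).
split; last 2 first.
- by rewrite -(in_cone_mxdiag (e_eff _)); apply: (e_prob ord0).
- by rewrite -(in_cone_mxdiag (e_eff _)); apply: (e_prob ord_max).
move=> i v; have q_ge0 j : 0 <= qform (submxblock (e j) i i) v.
  by case: (psd_submxblock i (e_eff j)) => _; apply.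
split=> //.
have -> : 1%:M = \sum_j submxblock (e j) i i.
  rewrite -submxblock_sum e_sum -(mxdiagZ (p_ := @blockdim A)).
  by rewrite submxblock_diag.
rewrite qform_sum (bigD1 (widen_ord le2M ord0)) //= lerD2l.
by rewrite (bigD1 (widen_ord le2M ord_max)) //= lerDl sumr_ge0.
Qed.

(** * The two implications for a single system *)

Lemma perfect_distinguishability_classical (R : realType) (A : qsystem) :
  perfect_distinguishability R A -> classical A.
Proof.
move=> PD; suff dim1 i : @blockdim A i = 1%N.
  rewrite /classical /sysdim; under eq_bigr do rewrite dim1.
  by rewrite sum1_card card_ord.
apply/eqP; rewrite eqn_leq blockdim_gt0 andbT leqNgt; apply/negP => dim_gt1.
pose o0 := Ordinal (ltnW dim_gt1); pose o1 := Ordinal dim_gt1.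
pose x : 'cV[R[i]]_(blockdim i) := delta_mx o0 0.
pose y : 'cV[R[i]]_(blockdim i) := delta_mx o0 0 + delta_mx o1 0.
have qsum (v : 'cV[R[i]]_(blockdim i)) :
    qform 1%:M v = \sum_k v k 0 * (v k 0)^*.
  rewrite /qform mulmx1 mxE; apply: eq_bigr => k _.
  by rewrite !mxE mulrC.
(* All vectors involved are supported on the coordinates [o0] and [o1], so two terms give their
   squared norms. *)
have qsum2 (v : 'cV[R[i]]_(blockdim i)) :
    (forall k, k != o0 -> k != o1 -> v k 0 = 0) ->
    qform 1%:M v = v o0 0 * (v o0 0)^* + v o1 0 * (v o1 0)^*.
  move=> v0; rewrite qsum (bigD1 o0) //= (bigD1 o1) //= big1 ?addr0 //.
  by move=> k /andP[k0 k1]; rewrite v0 // mul0r.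
have qx : qform 1%:M x = 1.
  rewrite qsum2 => [|k /negPf k0 _]; rewrite !mxE ?k0 //=.
  by rewrite mul0r conjC1 mulr1 addr0.
have qy : qform 1%:M y = 2.
  rewrite qsum2 => [|k /negPf k0 /negPf k1]; rewrite !mxE ?k0 ?k1 ?addr0 //=.
  by rewrite !add0r conjC1 !mulr1.
have qz : qform 1%:M (x *+ 2 - y) = 2.
  rewrite qsum2 => [|k /negPf k0 /negPf k1]; rewrite !mxE ?k0 ?k1 //=.
    by rewrite !addr0 !add0r addrK conjCN1 conjC1 mulrNN !mulr1.
  by rewrite !addr0 subr0.
have pure_x : normalized_pure_state (block_embed (1 *: (x *m x ^t*))).
  by apply: block_embed_pure; rewrite ?ler01 ?mul1r.
have pure_y : normalized_pure_state (block_embed (2^-1 *: (y *m y ^t*))).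
  apply: block_embed_pure; first by rewrite invr_ge0 ler0n.
  by rewrite qy mulVf // pnatr_eq0.
have neq_xy : block_embed (1 *: (x *m x ^t*)) <>
              block_embed (2^-1 *: (y *m y ^t*)).
  (* At entry [(o1, o1)] the first state has 0 and the second 1/2. *)
  move/block_embed_inj/matrixP/(_ o1 o1).
  rewrite !mxE !big_ord1 !mxE /= mul0r mulr0 add0r conjC1 !mulr1 => /eqP.
  by rewrite eq_sym invr_eq0 pnatr_eq0.
have [e [f [ef_pos]]] := pair_distinguishableP (PD _ _ pure_x pure_y neq_xy).
rewrite !prob_block_embed mul1r => ex fy.
case: pure_x pure_y => _ trx _ [_ try _]; rewrite trx in ex; rewrite try in fy.
have {}fy : qform (f i) y = 2.
  have nz2 : (2 : R[i]) != 0 by rewrite pnatr_eq0.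
  by apply: (mulfI (invr_neq0 nz2)); rewrite fy mulVf.
(* The form of [f i] at [y] already exhausts the squared norm 2 of [y], leaving nothing for
   [e i]. *)
have ey : qform (e i) y = 0.
  have [e_ge0 _] := ef_pos i y; rewrite fy qy gerDr => e_le0.
  by apply/eqP; rewrite eq_le e_le0.
have [_ f_ge0] := ef_pos i (x *+ 2 - y); rewrite qz => e_le.
have [e_ge0 _ _] := ef_pos i (x - y *+ 2).
have := qform_difference_of_squares (e i) x y; rewrite ex ey subr0 => /eqP.
rewrite subr_eq => /eqP e_eq; move: e_le; rewrite e_eq => e_le.
(* By now [e_le] bounds by 2 the sum of 3 and two nonnegative forms: that of [e i] at [x - 2y] and
   that of [f i] at [2x - y]. *)
have : (3 : R[i]) <= 2.
  by apply: le_trans e_le; rewrite -addrA lerDl addr_ge0.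
by rewrite ler_nat.
Qed.

Lemma indistinguishability_fully_quantum (R : realType) (A : qsystem) :
  indistinguishability R A -> fully_quantum A.
Proof.
move=> ID; apply/eqP; rewrite eqn_leq nblocks_gt0 andbT leqNgt.
apply/negP => blocks_gt1.
pose i0 := Ordinal (ltnW blocks_gt1); pose i1 := Ordinal blocks_gt1.
(* The witness is the projector onto the first basis vector of block [i]. *)
have pure i : exists C, normalized_pure_state (@block_embed R A i C).
  pose o := Ordinal (blockdim_gt0 i).
  exists (1 *: (delta_mx o 0 *m (delta_mx o 0 : 'cV_(blockdim i)) ^t*)).
  apply: block_embed_pure; rewrite ?ler01 // mul1r /qform mulmx1 mxE.
  rewrite (bigD1 o) //= big1 => [|k /negPf ko]; rewrite !mxE ?ko ?mulr0 //.
  by rewrite eqxx conjC1 mulr1 addr0.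
have [[C0 pure0] [C1 pure1]] := (pure i0, pure i1).
have [chi [pure_chi dist0 dist1]] := ID _ _ pure0 pure1.
have chi_cone : in_cone chi by case: pure_chi.
(* Whichever block [chi] misses, the state chosen in that block is distinguishable from it. *)
have [||chi0|chi1] := @pure_state_block_eq0 _ _ chi i0 i1 => //.
  exact/dist0/disjoint_blocks_distinguishable.
exact/dist1/disjoint_blocks_distinguishable.
Qed.

Theorem mainTheorem8 (R : realType) :
  (forall A : qsystem, perfect_distinguishability R A -> classical A) /\
  (forall A : qsystem, indistinguishability R A -> fully_quantum A) /\
  (forall T : quantum_theory,
     (forall A : qsystem, T A -> perfect_distinguishability R A) ->
     classical_theory T) /\
  (forall T : quantum_theory,
     (forall A : qsystem, T A -> indistinguishability R A) ->
     fully_quantum_theory T).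
Proof.
have PD := @perfect_distinguishability_classical R.
have ID := @indistinguishability_fully_quantum R.
by do !split=> //; move=> T HT A TA; [apply/PD/HT | apply/ID/HT].
Qed.
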